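(* Let $S$ be a countably infinite discrete semigroup which is weakly cancellative. Then there is a minimal left ideal $L$ of $S^*$ such that: (1) $L$ is a weak $P$-set in $S^*$; and, if $S$ is moreover left cancellative, then also (2) $L$ is prime in $S^*$, i.e., for all $p,q\in S^*$, $p\cdot q\in L$ if and only if $q\in L$; (3) every idempotent in $L$ is left-maximal in $S^*$ (in particular, every idempotent in $L$ is simultaneously minimal and maximal among the idempotents of $S^*$).
   Context: $\beta S$ is the set of all ultrafilters on $S$ (points of $S$ being identified with principal ultrafilters), topologized by the basic open sets $\overline{A}=\{p\in\beta S: A\in p\}$, $A\subseteq S$. $S^*=\beta S\setminus S$ is the set of free ultrafilters, with the subspace topology. The operation of $S$ extends to $\beta S$ by $p\cdot q=\{A\subseteq S:\{s\in S: s^{-1}A\in q\}\in p\}$, where $s^{-1}A=\{t\in S: s\cdot t\in A\}$; thus $x\mapsto x\cdot p$ is continuous on $\beta S$ for each $p\in\beta S$ and $x\mapsto s\cdot x$ is continuous for each $s\in S$. For $s\in S$ let $\lambda_s(x)=s\cdot x$ and $\rho_s(x)=x\cdot s$. $S$ is weakly cancellative if $\lambda_s^{-1}(t)$ and $\rho_s^{-1}(t)$ are finite for all $s,t\in S$. $S$ is left cancellative if every $\lambda_s$ is one-to-one. If $S$ is infinite and weakly cancellative, then $S^*$ is a two-sided ideal of $\beta S$, hence a semigroup, and the minimal left ideals of $S^*$ are exactly those of $\beta S$. A left ideal of a semigroup $T$ is a nonempty $L\subseteq T$ with $T\cdot L\subseteq L$; it is minimal if it properly contains no other left ideal. A subset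 $X$ of a topological space $Y$ is a weak $P$-set in $Y$ if $\overline{D}\cap X=\emptyset$ for every countable $D\subseteq Y\setminus X$. For idempotents $p,q$: $p\le_L q$ iff $p\cdot q=p$; $p\le_R q$ iff $q\cdot p=p$; $p\le q$ iff $p\le_L q$ and $p\le_R q$. An idempotent $p\in S^*$ is left-maximal in $S^*$ if for every idempotent $q\in S^*$, $p\le_L q$ implies $q\le_L p$. ''Minimal'' and ''maximal'' without qualification refer to $\le$ among the idempotents of $S^*$. *)

(* Defs.v *)
From HB Require Import structures.
From mathcomp Require Import all_boot.
From mathcomp Require Import boolp classical_sets functions cardinality filter.
From mathcomp Require Import topology.

Set Implicit Arguments.
Unset Strict Implicit.
Unset Printing Implicit Defensive.

Local Open Scope classical_set_scope.
Local Open Scope group_scope.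

(* The coercion to functions lets [p A] stand for "A belongs to p". *)
Record betaS (S : Type) := BetaS {
  ultra_sets :> set S -> Prop;
  ultra_setsP : @UltraFilter S ultra_sets }.

#[export] Existing Instance ultra_setsP.

HB.instance Definition _ (S : Type) := gen_eqMixin (betaS S).
HB.instance Definition _ (S : Type) := gen_choiceMixin (betaS S).

Lemma betaS_eq (S : Type) (p q : betaS S) :
  ultra_sets p = ultra_sets q -> p = q.
Proof.
case: p q => [p pU] [q qU] /= pq; case: _ / pq qU => qU.
by rewrite (Prop_irrelevance pU qU).
Qed.

Lemma ultra_setC (S : Type) (F : set_system S) : ProperFilter F ->
  (forall A, F A \/ F (~` A)) -> UltraFilter F.
Proof.
move=> FF FC; split => // G GF FG; apply/seteqP; split => // A GA.
have [//|FnA] := FC A.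
by have /filter_ex [? []] : G (A `&` ~` A) by apply: filterI => //; exact: FG.
Qed.

Definition beta_principal (S : Type) (s : S) : betaS S :=
  BetaS (principal_filter_ultra s).

Definition free_ultra (S : Type) : set (betaS S) :=
  ~` range (@beta_principal S).

Section BetaTopology.
Variable S : Type.

Definition beta_basic (A : set S) : set (betaS S) := [set p : betaS S | p A].

Lemma beta_basic_cover : \bigcup_(A in [set: set S]) beta_basic A = setT.
Proof.
by apply/seteqP; split => // p _; exists setT => //; exact: filterT.
Qed.

Lemma beta_basic_join (A B : set S) (p : betaS S) :
  [set: set S] A -> [set: set S] B -> beta_basic A p -> beta_basic B p ->
  exists C, [/\ [set: set S] C, beta_basic C p &
    beta_basic C `<=` beta_basic A `&` beta_basic B].
Proof.
move=> _ _ pA pB; exists (A `&` B); split => //; first exact: filterI.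
by move=> q qAB; split; apply: filterS qAB => x [].
Qed.

HB.instance Definition _ :=
  isBaseTopological.Build (betaS S) beta_basic_cover beta_basic_join.

End BetaTopology.

Section BetaProduct.
Variable S : semigroupType.

Definition beta_mul_sets (p q : betaS S) : set_system S :=
  [set A | p [set s | q (mul s @^-1` A)]].

Lemma beta_mul_ultra (p q : betaS S) : UltraFilter (beta_mul_sets p q).
Proof.
apply: ultra_setC.
  apply: Build_ProperFilter_ex.
    move=> A pA; have [s /= qA] := @filter_ex _ (ultra_sets p) _ _ pA.
    by have [t At] := filter_ex qA; exists (s * t).
  split.
  - rewrite /beta_mul_sets /=; apply: filterS filterT => s _; exact: filterT.
  - by move=> A B; apply: (@filterS2 _ (ultra_sets p)) => s /= qA qB; exact: filterI.
  - move=> A B AB; rewrite /beta_mul_sets /=; apply: filterS => s /=; apply: filterS => t; exact: AB.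
move=> A; have pU := ultra_setsP p; have qU := ultra_setsP q.
have [pA|pA] := in_ultra_setVsetC [set s | q (mul s @^-1` A)] pU.
  by left.
right; apply: filterS pA => s /= nqA.
by have [//|] := in_ultra_setVsetC (mul s @^-1` A) qU.
Qed.

Definition beta_mul (p q : betaS S) : betaS S := BetaS (beta_mul_ultra p q).

Lemma beta_mulA : associative beta_mul.
Proof.
move=> p q r; apply: betaS_eq; apply: funext => A.
rewrite /= /beta_mul_sets /=; congr (ultra_sets p _); apply: funext => s /=.
congr (ultra_sets q _); apply: funext => t /=.
by congr (ultra_sets r _); apply: funext => u /=; rewrite mulgA.
Qed.

HB.instance Definition _ := isSemigroup.Build (betaS S) beta_mulA.

End BetaProduct.

Definition weakly_cancellative (S : semigroupType) : Prop :=
  forall s t : S, finite_set ((fun x => s * x) @^-1` [set t]) /\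
                  finite_set ((fun x => x * s) @^-1` [set t]).

Definition left_cancellative (S : semigroupType) : Prop :=
  forall s : S, injective (fun x => s * x).

(* The closure is taken in the subspace topology of Y. *)
Definition weak_Pset (T : topologicalType) (Y X : set T) : Prop :=
  X `<=` Y /\
  forall D : set T, D `<=` Y `\` X -> countable D ->
    @closure (subspace Y) D `&` X = set0.

(* Below, T is a subset of the semigroup G, meant to be a subsemigroup. *)
Section SubsemigroupNotions.
Variable G : semigroupType.
Implicit Types (T L : set G) (p q : G).

Definition left_ideal T L : Prop :=
  [/\ L !=set0, L `<=` T & forall p q, T p -> L q -> L (p * q)].

Definition minimal_left_ideal T L : Prop :=
  left_ideal T L /\ forall L', left_ideal T L' -> L' `<=` L -> L' = L.

Definition prime_in T L : Prop :=
  forall p q, T p -> T q -> (L (p * q) <-> L q).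

Definition idempotents T : set G := [set p | T p /\ p * p = p].

Definition idem_leL p q : Prop := p * q = p.
Definition idem_leR p q : Prop := q * p = p.
Definition idem_le p q : Prop := idem_leL p q /\ idem_leR p q.

Definition left_maximal T p : Prop :=
  idempotents T p /\
  forall q, idempotents T q -> idem_leL p q -> idem_leL q p.

Definition minimal_idempotent T p : Prop :=
  idempotents T p /\ forall q, idempotents T q -> idem_le q p -> q = p.

Definition maximal_idempotent T p : Prop :=
  idempotents T p /\ forall q, idempotents T q -> idem_le p q -> q = p.

End SubsemigroupNotions.

(* Main.v *)
Require Import Defs.
From HB Require Import structures.
From mathcomp Require Import all_boot.
From mathcomp Require Import boolp classical_sets functions cardinality filter.
From mathcomp Require Import topology.
From mathcomp Require wochoice.

Set Implicit Arguments.
Unset Strict Implicit.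
Unset Printing Implicit Defensive.

Local Open Scope classical_set_scope.
Local Open Scope group_scope.

(** The ideal [L] is the set of all ultrafilters that extend a filter [F] on [S]
built by transfinite recursion in the style of Kunen's construction of weak
P-points.  [F] contains the cofinite sets and [s^-1 A] together with [A], so
[L] is a closed left ideal.  Two further properties are forced on [F], one
task [t : nat -> set S] at a time ([handled]):

- if [t] lists a single set [A], then either [A] is in [F], or the complement
  of [A] is syndetic relative to [F].  This makes [S q] dense in [L] for each
  [q] in [L], so [L] is minimal;
- if all sets [t n] are in [F], then [F] contains uncountably many sets [V b]
  such that a free ultrafilter which omits one of the [t n] contains only
  finitely many of the [V b].  Given countably many free ultrafilters outside
  [L], choose for each of them a set of [F] which it omits.  Some [V b] is then
  in none of these ultrafilters, so [L] is a weak P-set.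

The recursion goes through ([handle_task]) because a family of sets stays
independent over the current filter, in a sense adapted to invariance: an
intersection of its members still has a point in common with finitely many of
its left translates and a set of the filter.  A task destroys only finitely
many rows of the family.  There are as many rows as tasks, the tasks are well
ordered with initial segments shorter than the whole, and a diagonal argument
([short_segments_fresh]) finds an intact row at each stage.  Kunen's
independent linked family lives on a countable set of nodes; [linked_family]
carries it over to [S] by means of disjoint finite blocks, each containing
many left translates of one of its points.

Primality follows from the weak P-set property: if [p q] is in [L], then some
[s q] is in [L], since otherwise [p q] would be in the closure of countably
many points outside [L].  An idempotent [e] of [L] satisfies [s q e = s q], so
[q = q e] is in [L] by left cancellation.  The statements on idempotents follow
from primality and from the fact that idempotents of a minimal left ideal are
right identities of it. *)

(** * Ultrafilters and the topology of beta S *)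

Lemma ultra_not (S : Type) (d : betaS S) (A : set S) : ~ d A -> d (~` A).
Proof. by have [] := in_ultra_setVsetC A (ultra_setsP d). Qed.

Lemma ultra_notC (S : Type) (d : betaS S) (A : set S) : d A -> ~ d (~` A).
Proof. by move=> dA dnA; have [x []] := filter_ex (filterI dA dnA). Qed.

Lemma betaS_le_eq (S : Type) (p q : betaS S) : p `<=` q -> p = q.
Proof. by move=> pq; apply/esym/betaS_eq; exact: max_filter. Qed.

Lemma filter_forall_in (I : eqType) (X : Type) (F : set_system X) (s : seq I)
  (P : I -> set X) {FF : Filter F} : (forall i, i \in s -> F (P i)) ->
  F [set x | forall i, i \in s -> P i x].
Proof.
elim: s => [_|i s ih sP]; first by apply: filterS filterT.
have Fs : F [set x | forall i, i \in s -> P i x].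
  by apply: ih => i' i's; apply: sP; rewrite inE i's orbT.
apply: filterS (filterI (sP i (mem_head _ _)) Fs) => x [xi xs] i'.
by rewrite inE => /orP[/eqP ->//|]; exact: xs.
Qed.

Lemma free_ultra_finite (S : Type) (d : betaS S) (A : set S) :
  free_ultra d -> finite_set A -> ~ d A.
Proof.
move=> fd.
suff main (s : seq {classic S}) : ~ d [set` s].
  by move=> /(@finite_seqP {classic S})[s ->]; exact: main.
elim: s => [|x s ih] dxs; first by have [y] := filter_ex dxs.
apply: fd; exists x => //; apply: betaS_le_eq => B /principal_filterP Bx.
apply: filterS (filterI dxs (ultra_not ih)) => y /= [].
by rewrite inE => /orP[/eqP ->|].
Qed.

Section BetaSpace.
Variable S : Type.
Implicit Types (p q : betaS S) (G C : set_system S).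

(** Compactness of beta S: the closed set of ultrafilters above [G] meets a
directed intersection of basic clopen sets as soon as it meets each of them. *)
Lemma ultra_extend G C : Filter G -> C setT -> (forall A B, C A -> C B -> C (A `&` B)) ->
  (forall A B, G A -> C B -> (A `&` B) !=set0) ->
  exists p : betaS S, G `<=` p /\ C `<=` p.
Proof.
move=> FG CT CI GC.
have HF : ProperFilter [set D | exists A B, [/\ G A, C B & A `&` B `<=` D]].
  apply: Build_ProperFilter_ex.
    by move=> D [A [B [GA CB sub]]]; have [x xAB] := GC A B GA CB; exists x; exact: sub.
  split.
  - by exists setT, setT; split => //; exact: filterT.
  - move=> D D' [A [B [GA CB sub]]] [A' [B' [GA' CB' sub']]].
    exists (A `&` A'), (B `&` B'); split; [exact: filterI|exact: CI|].
    by move=> x [[? ?] [? ?]]; split; [exact: sub|exact: sub'].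
  - move=> D D' DD' [A [B [GA CB sub]]]; exists A, B; split => //.
    exact: subset_trans DD'.
have [p [pU Hp]] := ultraFilterLemma HF; exists (BetaS pU); split => A /= HA.
  by apply: Hp; exists A, setT; split => // x [].
by apply: Hp; exists setT, A; split => //; exact: filterT.
Qed.

Lemma filter_ultraP G A : Filter G -> (forall p, G `<=` p -> p A) -> G A.
Proof.
move=> FG GA; apply: contrapT => nGA.
have [|||p [Gp pA]] := @ultra_extend G [set D | ~` A `<=` D] FG.
- by [].
- by move=> B C AB nAC x nAx; split; [exact: AB|exact: nAC].
- move=> B C GB nAC; apply: contrapT => BC0; apply: nGA; apply: filterS GB => x Bx.
  by apply: contrapT => nAx; apply: BC0; exists x; split => //; exact: nAC.
- by apply: (ultra_notC (GA p Gp)); exact: pA.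
Qed.

Lemma beta_basic_open (A : set S) : open (beta_basic A).
Proof. by exists [set A] => //; rewrite bigcup_set1. Qed.

Lemma beta_nbhsP p (U : set (betaS S)) :
  nbhs p U <-> exists2 A, p A & beta_basic A `<=` U.
Proof.
split => [|[A pA AU]]; last first.
  by apply: filterS AU _; apply: open_nbhs_nbhs; split => //; exact: beta_basic_open.
rewrite nbhsE => -[V [[D _ <-] [A DA pA]] VU]; exists A => // q qA.
by apply: VU; exists A.
Qed.

Lemma closure_subspace_betaP (Y D : set (betaS S)) p : Y p -> D `<=` Y ->
  (@closure (subspace Y) D p <-> forall A, p A -> exists2 q, D q & q A).
Proof.
move=> Yp DY; split => [clp A pA|clp U].
  have [|q [Dq qA]] := clp (beta_basic A); last by exists q.
  rewrite /nbhs /= -nbhs_subspace_in //; apply: filterS (_ : nbhs p (beta_basic A)).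
    by move=> q.
  by apply/beta_nbhsP; exists A.
rewrite /nbhs /= -nbhs_subspace_in // => /beta_nbhsP[A pA AU].
by have [q Dq qA] := clp A pA; exists q; split => //; apply: AU => //; exact: DY.
Qed.

End BetaSpace.

(** * An independent linked family on a countable set *)

Definition bits := nat -> bool.
HB.instance Definition _ := gen_eqMixin bits.
HB.instance Definition _ := gen_choiceMixin bits.

Definition restr (k : nat) (x : bits) : k.-tuple bool := [tuple x i | i < k].

(** Distinct 0-1 sequences differ at some place, and finitely many pairs have a
common bound for such places. *)
Lemma restr_inj_on (s : seq bits) : exists k0, forall k, k0 <= k ->
  {in s &, injective (restr k)}.
Proof.
have sep (x y : bits) : exists k0, forall k, k0 <= k -> restr k x = restr k y -> x = y.
  have [->|xy] := EM (x = y); first by exists 0.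
  have [i xyi] : exists i, x i != y i.
    apply: contrapT => nxy; apply: xy; apply: funext => i.
    by have [//|xyi] := eqVneq (x i) (y i); case: nxy; exists i.
  exists i.+1 => k ik /(congr1 (fun t => tnth t (Ordinal ik))).
  by rewrite !tnth_mktuple /= => /eqP; rewrite (negbTE xyi).
have {}sep (x : bits) : exists k0, forall k, k0 <= k -> forall y, y \in s ->
    restr k x = restr k y -> x = y.
  elim: s => [|z s [k0 ih]]; first by exists 0.
  have [k1 xz] := sep x z; exists (maxn k0 k1) => k; rewrite geq_max => /andP[kk0 kk1] y.
  by rewrite inE => /orP[/eqP->|ys]; [exact: xz|exact: ih].
have [k0 k0P] : exists k0, forall x, x \in s -> forall k, k0 <= k -> forall y, y \in s ->
    restr k x = restr k y -> x = y.
  elim: {1}s => [|z r [k0 ih]]; first by exists 0.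
  have [k1 xz] := sep z; exists (maxn k0 k1) => x.
  rewrite inE => xr k; rewrite geq_max => /andP[kk0 kk1] y ys.
  by move: xr => /orP[/eqP->|xr]; [exact: xz|exact: ih].
by exists k0 => k kk x y xs ys; exact: k0P.
Qed.

Section Conditions.
Variables (J : eqType) (X : Type) (A : J -> bits -> nat -> set X).

(** A pair [(j, Q)] of [c] asks for membership in the sets of row [j] and of the
columns in [Q].  The level is the number of these columns: it is the lowest one
at which linkedness allows so many sets of a row to have a large intersection. *)
Definition condition (c : seq (J * seq bits)) : set X :=
  [set x | forall jQ, jQ \in c -> forall b, b \in jQ.2 -> A jQ.1 b (size jQ.2) x].

Lemma condition_cat c1 c2 : condition (c1 ++ c2) = condition c1 `&` condition c2.
Proof.
apply/seteqP; split => [x xC|x [xC1 xC2] jQ].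
  by split=> jQ jQc; apply: xC; rewrite mem_cat jQc ?orbT.
by rewrite mem_cat => /orP[/xC1|/xC2].
Qed.

End Conditions.

(** A node guesses, at a finite depth [k], for each restricted row a set of
restricted columns. *)
Definition node := {k : nat & {ffun k.-tuple bool -> {set k.-tuple bool}}}.

Definition node_sets (j b : bits) (n : nat) : set node :=
  fun w => #|tagged w (restr (tag w) j)| <= n /\
           restr (tag w) b \in tagged w (restr (tag w) j).

(** Once [k] separates the rows and the columns in [c], the node which guesses
for each row exactly the columns that [c] asks for satisfies [c]. *)
Lemma node_sets_independent (c : seq (bits * seq bits)) : uniq (map fst c) ->
  exists k0, forall k, k0 <= k -> exists w : node, tag w = k /\ condition node_sets c w.
Proof.
move=> uc; have [k0 k0P] := restr_inj_on (map fst c); exists k0 => k /k0P rinj.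
pose f : {ffun k.-tuple bool -> {set k.-tuple bool}} := [ffun u => [set v |
  has (fun jQ => (restr k jQ.1 == u) && (v \in map (restr k) jQ.2)) c]%SET].
exists (existT _ k f); split => // -[j Q] jQc b bQ /=.
have fj : f (restr k j) = [set:: map (restr k) Q]%SET.
  apply/setP => v; rewrite ffunE !inE; apply/hasP/idP => [[[j' Q'] j'c /=]|vQ].
    move=> /andP[/eqP jj']; suff -> : Q = Q' by [].
    have {}jj' : j' = j.
      by apply: rinj jj'; apply/mapP; [exists (j', Q')|exists (j, Q)].
    subst j'; elim: c {f k0 k0P rinj} uc jQc j'c => //= -[j1 Q1] c ih /= /andP[jc uc].
    rewrite !inE => /orP[/eqP[e1 e2]|jQc] /orP[/eqP[e3 e4]|j'c]; first by rewrite e2 e4.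
    - by move: jc; rewrite -e1 => /mapP[]; exists (j, Q').
    - by move: jc; rewrite -e3 => /mapP[]; exists (j, Q).
    - exact: ih.
  by exists (j, Q) => //=; rewrite eqxx.
rewrite /node_sets /= fj; split; last by rewrite inE map_f.
by rewrite cardsE (leq_trans (card_size _)) ?size_map.
Qed.

(** Once [k] separates the columns in [Q], a guess of at most [n] restricted
columns cannot contain all of them. *)
Lemma node_sets_linked (j : bits) (n : nat) (Q : seq bits) : uniq Q -> n < size Q ->
  exists k0, forall w, (forall b, b \in Q -> node_sets j b n w) -> tag w < k0.
Proof.
move=> uQ nQ; have [k0 k0P] := restr_inj_on Q; exists k0 => w wQ.
rewrite ltnNge; apply/negP => /k0P rinj.
have [wn _] : node_sets j (head (fun=> false) Q) n w.
  by apply: wQ; case: (Q) nQ => //= b r _; rewrite inE eqxx.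
move: nQ; rewrite ltnNge => /negP; apply; apply: leq_trans wn.
rewrite -(size_map (restr (tag w))) cardE; apply: uniq_leq_size.
  by rewrite map_inj_in_uniq.
by move=> v /mapP[b /wQ[_ wb] ->]; rewrite mem_enum.
Qed.

Lemma finite_node_level (k0 : nat) : finite_set [set w : node | tag w < k0].
Proof.
have -> : [set w : node | tag w < k0] =
    \bigcup_(k in `I_k0) (range (existT _ k) : set node).
  apply/seteqP; split => [[k f] /= kk0|_ [k kk0 [f _ <-]]] //.
  by exists k => //; exists f.
apply: bigcup_finite => // k _; apply: finite_image; exact: finite_finset.
Qed.

(** * Transfer to the semigroup by disjoint blocks *)

(** The finite approximations to the largest left invariant subset of [A].  A
filter that contains [hull E A] for all finite [E] has only ultrafilters [p]
above it with [A] in [p] and in [s p] for every [s]. *)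
Definition hull (S : semigroupType) (E A : set S) : set S :=
  [set x | A x /\ forall s, E s -> A (s * x)].

Section Blocks.
Variables (S : semigroupType) (e : nat -> S) (size_of : nat -> nat).
Hypotheses (S_infinite : infinite_set [set: S])
  (S_weakly_cancellative : weakly_cancellative S).

(** For [e] an enumeration of [S], a growing number of left translates of [x]
together with [x] itself. *)
Definition block (m : nat) (x : S) : set S :=
  [set y | y = x \/ exists2 i, i < size_of m & y = e i * x].

Lemma finite_block m x : finite_set (block m x).
Proof.
apply: (@sub_finite_set _ _ ([set x] `|` (fun i => e i * x) @` `I_(size_of m))).
  by move=> y [->|[i im ->]]; [left|right; exists i].
by rewrite finite_setU; split => //; apply: finite_image; exact: finite_II.
Qed.

(** By weak cancellativity only finitely many [x] have a block meeting [Z]. *)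
Lemma block_avoiding (Z : set S) m : finite_set Z ->
  exists x, (forall i, i < size_of m -> x <> e i) /\ block m x `&` Z = set0.
Proof.
move=> fZ; pose bad := Z `|` (e @` `I_(size_of m) `|`
  \bigcup_(i in `I_(size_of m)) \bigcup_(z in Z) ((fun x => e i * x) @^-1` [set z])).
have fbad : finite_set bad.
  rewrite !finite_setU; split => //; split; first exact: finite_image (finite_II _).
  apply: bigcup_finite (finite_II _) _ => i _; apply: bigcup_finite fZ _ => z _.
  by have [] := S_weakly_cancellative (e i) z.
have [x nbx] : exists x, ~ bad x.
  apply: contrapT => nex; apply: S_infinite; apply: sub_finite_set fbad => x _.
  by apply: contrapT => nx; apply: nex; exists x.
exists x; split.
  by move=> i im xe; apply: nbx; right; left; exists i.
apply/seteqP; split => // y [[->|[i im ->]] Zy]; apply: nbx; first by left.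
by right; right; exists i => //; exists (e i * x).
Qed.

(** Points chosen one by one, each block avoiding the union of the earlier
ones. *)
Lemma disjoint_blocks : exists x : nat -> S,
  (forall m i, i < size_of m -> x m <> e i) /\
  (forall m m' y, block m (x m) y -> block m' (x m') y -> m = m').
Proof.
have [pick pickP] : {pick : set S * nat -> S & forall Zm, finite_set Zm.1 ->
    (forall i, i < size_of Zm.2 -> pick Zm <> e i) /\ block Zm.2 (pick Zm) `&` Zm.1 = set0}.
  apply: (choice (P := fun Zm x => finite_set Zm.1 ->
    (forall i, i < size_of Zm.2 -> x <> e i) /\ block Zm.2 x `&` Zm.1 = set0)).
  move=> [Z m] /=; have [fZ|nfZ] := pselect (finite_set Z).
    by have [x xP] := @block_avoiding Z m fZ; exists x.
  by exists (e 0).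
pose used := fix used m : set S :=
  if m is m'.+1 then used m' `|` block m' (pick (used m', m')) else set0.
have fused m : finite_set (used m).
  by elim: m => //= m ih; rewrite finite_setU; split => //; exact: finite_block.
have used_le m m' y : m <= m' -> used m y -> used m' y.
  move=> /subnK <-; elim: (m' - m) => //= k ih /ih; first by left.
exists (fun m => pick (used m, m)); split.
  by move=> m i im; have [+ _] := pickP (used m, m) (fused m); apply.
suff disj m m' y : m < m' -> block m (pick (used m, m)) y ->
    block m' (pick (used m', m')) y -> False.
  by move=> m m' y ym ym'; case: (ltngtP m m') => // h; [case: (disj _ _ _ h ym ym')|
     case: (disj _ _ _ h ym' ym)].
move=> mm' ym ym'; have [_ /seteqP[+ _]] := pickP (used m', m') (fused m').
by move=> /(_ y); apply; split => //=; apply: used_le mm' _; right.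
Qed.

End Blocks.

Section LinkedFamily.
Variables (S : semigroupType) (S_countable : countable [set: S])
  (S_infinite : infinite_set [set: S])
  (S_weakly_cancellative : weakly_cancellative S).

(** Each node owns a block of [S], and a set of nodes is replaced by its preimage
under a finite-to-one partial map that sends each block to its owner.  Finite
sets of nodes have finite preimages, which are in no free ultrafilter, so
linkedness carries over.  The
block of a deep node contains its base point with many left translates, so a
condition that holds at deep nodes has a large hull. *)
Lemma linked_family : exists A : bits -> bits -> nat -> set S,
  [/\ forall j b m n, m <= n -> A j b m `<=` A j b n,
      forall j n (d : betaS S), free_ultra d -> finite_set [set b | d (A j b n)]
    & forall c, uniq (map fst c) -> forall B E, finite_set (~` B) -> finite_set E ->
        (B `&` hull E (condition A c)) !=set0].
Proof.
have [r rinj] : exists r : S -> nat, injective r.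
  have /countable_injP[r rinj] := S_countable; exists r => x y; exact: rinj (mem_setT _) (mem_setT _).
have [x0 _] : [set: S] !=set0.
  by apply: contrapT => /set0P/negP; rewrite negbK => /eqP h; apply: S_infinite; rewrite h.
have [e eK] : exists e : nat -> S, forall s, e (r s) = s.
  have [e eP] : {e : nat -> S & forall n s, r s = n -> e n = s}.
    apply: (choice (P := fun n x => forall s, r s = n -> x = s)) => n.
    have [[s sn]|ns] := pselect (exists s, r s = n).
      by exists s => s' s'n; apply: rinj; rewrite sn.
    by exists x0 => s sn; case: ns; exists s.
  by exists e => s; exact: eP.
(* The block of a node contains as many translates as the depth of the node. *)
pose level m := if pickle_inv m is Some w then tag (w : node) else 0.
have [x [xe xdisj]] := disjoint_blocks e level S_infinite S_weakly_cancellative.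
(* Outside of the blocks [p] follows the injection [r], so it stays finite-to-one. *)
have [p pP] : {p : S -> nat & forall y, (forall m, block e level m (x m) y -> p y = m) /\ ((forall m, ~ block e level m (x m) y) -> p y = r y)}.
  apply: (choice (P := fun y n => (forall m, block e level m (x m) y -> n = m) /\ ((forall m, ~ block e level m (x m) y) -> n = r y))) => y.
  have [[m ym]|ny] := pselect (exists m, block e level m (x m) y).
    by exists m; split => [m' ym'|/(_ m)//]; exact: xdisj ym ym'.
  by exists (r y); split => // m ym; case: ny; exists m.
have fp m : finite_set (p @^-1` [set m]).
  apply: (@sub_finite_set _ _ (block e level m (x m) `|` [set e m])).
    move=> y /= ym; have [[m' ym']|ny] := pselect (exists m, block e level m (x m) y).
      by left; rewrite -ym (proj1 (pP y) m').
    by right; rewrite -ym (proj2 (pP y)) ?eK // => m' ?; apply: ny; exists m'.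
  by rewrite finite_setU; split => //; exact: finite_block.
pose A j b n : set S := [set y | exists2 w, pickle_inv (p y) = Some w & node_sets j b n w].
exists A; split.
- move=> j b m n mn y [w yw [wm wb]]; exists w => //; split => //; exact: leq_trans mn.
- move=> j n d fd; apply: contrapT => inf.
  have [Q [uQ Qsub nQ]] : exists Q : seq bits, [/\ uniq Q,
      forall b, b \in Q -> d (A j b n) & n < size Q].
    have [Q Qsub nQ] := infinite_set_fset n.+1 inf.
    by exists (finmap.enum_fset Q); split => //; exact: finmap.fset_uniq.
  have [k0 k0P] := @node_sets_linked j n Q uQ nQ.
  refine (free_ultra_finite fd _ (filter_forall_in Qsub)).
  have fin : finite_set (\bigcup_(w in [set w : node | tag w < k0]) p @^-1` [set pickle w]).
    by apply: bigcup_finite => //; exact: finite_node_level.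
  apply: sub_finite_set fin => y yQ; have [w yw] : exists w : node, pickle_inv (p y) = Some w.
    by case: (Q) nQ yQ => // b s _ /(_ b (mem_head _ _))[w]; exists w.
  exists w => /=; first by apply: k0P => b /yQ[w']; rewrite yw => -[<-].
  by have := pickle_invK (T := node) (p y); rewrite yw.
- move=> c /node_sets_independent[k0 k0P] B E fB fE.
  have [k [kk0 Bk Ek]] : exists k, [/\ k0 <= k, (forall y, ~ B y -> r y < k) &
      forall s, E s -> r s < k].
    have bound (Z : set S) : finite_set Z -> exists k, forall y, Z y -> r y < k.
      move=> /(@finite_seqP {classic S})[s ->].
      elim: s => [|z s [k ih]]; first by exists 0.
      exists (maxn k (r z).+1) => y /=; rewrite inE leq_max => /orP[/eqP->|/ih ->//].
      by rewrite leqnn orbT.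
    have [k1 k1P] := bound _ fB; have [k2 k2P] := bound _ fE.
    exists (maxn k0 (maxn k1 k2)); split.
    + exact: leq_maxl.
    + by move=> y /k1P yk1; rewrite !leq_max yk1 orbT.
    + by move=> y /k2P yk2; rewrite !leq_max yk2 !orbT.
  have [w [wk wc]] := k0P _ kk0.
  have wlevel : level (pickle w) = k by rewrite /level pickleK_inv.
  have blockc y : block e level (pickle w) (x (pickle w)) y -> condition A c y.
    move=> yw jQ jQc b bQ; exists w; last exact: wc.
    by rewrite (proj1 (pP y) _ yw) pickleK_inv.
  exists (x (pickle w)); split.
    apply: contrapT => /Bk; rewrite -wlevel => /xe.
    by rewrite eK.
  split; first by apply: blockc; left.
  move=> s /Ek; rewrite -wlevel => sk; apply: blockc; right.
  by exists (r s) => //; rewrite eK.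
Qed.

End LinkedFamily.

(** * Invariant filters *)

Definition invariant_filter (S : semigroupType) (F : set_system S) : Prop :=
  [/\ Filter F, forall A, finite_set (~` A) -> F A
    & forall A s, F A -> F (mul s @^-1` A)].

Section Hull.
Variable S : semigroupType.
Implicit Types (A B E : set S) (F P : set_system S).

Lemma hullS E E' A B : E `<=` E' -> A `<=` B -> hull E' A `<=` hull E B.
Proof. by move=> EE' AB x [Ax xE]; split => [|s /EE' /xE]; exact: AB. Qed.

Lemma hullI E A B : hull E A `&` hull E B `<=` hull E (A `&` B).
Proof. by move=> x [[Ax xA] [Bx xB]]; split => // s Es; split; [exact: xA|exact: xB]. Qed.

Lemma filter_hull F E A : Filter F -> finite_set E -> F A ->
  (forall s, E s -> F (mul s @^-1` A)) -> F (hull E A).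
Proof.
move=> FF /(@finite_seqP {classic S})[l ->] FA lA.
have Fl : F [set x | forall s : {classic S}, s \in l -> (mul s @^-1` A) x].
  by apply: filter_forall_in => s /lA.
by apply: filterS (filterI FA Fl).
Qed.

(** For [P] directed, the least invariant filter that contains [F] and [P]. *)
Definition adjoin F P : set_system S :=
  [set B | exists C D E, [/\ F C, P D, finite_set E & C `&` hull E D `<=` B]].

Lemma adjoin_sub F P : P !=set0 -> F `<=` adjoin F P.
Proof.
move=> [D PD] A FA; by exists A, D, set0; split => // x [].
Qed.

Lemma adjoin_self F P D : Filter F -> P D -> adjoin F P D.
Proof.
by move=> FF PD; exists setT, D, set0; split => // [|x [_ []]//]; exact: filterT.
Qed.

Lemma adjoin_invariant F P : invariant_filter F -> P !=set0 ->
  (forall A B, P A -> P B -> exists2 C, P C & C `<=` A `&` B) ->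
  invariant_filter (adjoin F P).
Proof.
move=> [FF Fcof Finv] P0 Pdir; split.
- split.
  + by apply: adjoin_sub P0 _ _; exact: filterT.
  + move=> A A' [C [D [E [FC PD fE sub]]]] [C' [D' [E' [FC' PD' fE' sub']]]].
    have [D2 PD2 D2sub] := Pdir _ _ PD PD'.
    exists (C `&` C'), D2, (E `|` E'); split => //; first exact: filterI.
      by rewrite finite_setU.
    move=> x [[Cx C'x] xD2]; split; [apply: sub; split => //|apply: sub'; split => //].
      by apply: hullS xD2; [move=> s; left|move=> y /D2sub[]].
    by apply: hullS xD2; [move=> s; right|move=> y /D2sub[]].
  + move=> A B AB [C [D [E [FC PD fE sub]]]]; exists C, D, E; split => //.
    exact: subset_trans AB.
- by move=> A fA; apply: adjoin_sub P0 _ _; exact: Fcof.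
- move=> A s [C [D [E [FC PD fE sub]]]].
  (* [s^-1 (u^-1 D) = (u s)^-1 D]; the singleton accounts for [D] itself in the hull *)
  exists (mul s @^-1` C), D, ([set s] `|` (fun u => u * s) @` E); split => //.
  + exact: Finv.
  + by rewrite finite_setU; split; [exact: finite_set1|exact: finite_image].
  + move=> x [Cx [Dx xD]]; apply: sub; split => //; split; first by apply: xD; left.
    by move=> u Eu; rewrite mulgA; apply: xD; right; exists u.
Qed.

End Hull.

(** * Handling one task *)

Definition initial_meet (X : Type) (t : nat -> set X) (n : nat) : set X :=
  [set x | forall k, k < n -> t k x].

Lemma initial_meetS (X : Type) (t : nat -> set X) m n : m <= n ->
  initial_meet t n `<=` initial_meet t m.
Proof. by move=> mn x tx k km; apply: tx; exact: leq_trans mn. Qed.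

Section Stages.
Variables (S : semigroupType) (J : eqType) (A : J -> bits -> nat -> set S).
Hypotheses (A_mono : forall j b m n, m <= n -> A j b m `<=` A j b n)
  (A_linked : forall j n (d : betaS S), free_ultra d ->
     finite_set [set b | d (A j b n)]).
Implicit Types (F : set_system S) (U : set J) (t : nat -> set S) (c : seq (J * seq bits)).

(** Every condition on rows outside of [U] defines a set that can be adjoined to
[F], in the sense of [adjoin], without making the filter improper. *)
Definition independent F U : Prop :=
  forall c, uniq (map fst c) -> (forall jQ, jQ \in c -> ~ U jQ.1) ->
  forall B E, F B -> finite_set E -> (B `&` hull E (condition A c)) !=set0.

(** The first alternative says that the complement of some [t 0 `&` .. `&` t n.-1]
is syndetic relative to [F]; it excludes this intersection from all proper
invariant filters above [F].  Both alternatives persist when [F] grows. *)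
Definition handled F t : Prop :=
  (exists n E, finite_set E /\ F (~` hull E (initial_meet t n))) \/
  (forall n, F (initial_meet t n)) /\
  exists V : bits -> set S, (forall b, F (V b)) /\
    forall (d : betaS S) n, free_ultra d -> ~ d (initial_meet t n) ->
      finite_set [set b | d (V b)].

Lemma handledS F F' t : F `<=` F' -> handled F t -> handled F' t.
Proof.
move=> FF' [[n [E [fE nE]]]|[Fm [V [FV Vlinked]]]].
  by left; exists n, E; split => //; exact: FF'.
right; split => [n|]; first exact: FF'.
by exists V; split => // b; exact: FF'.
Qed.

(** Kunen's sets: at the point [x], row [j] is used at the level [m] for which
[x] is in [t 0], .., [t m.-1] but not in [t m]. *)
Definition guess t j (b : bits) : set S :=
  [set x | forall m, initial_meet t m x -> ~ initial_meet t m.+1 x -> A j b m x].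

(** Off [initial_meet t n] only levels below [n] occur, so there
[guess t j b] is contained in [A j b n]. *)
Lemma guess_linked t j (d : betaS S) n : free_ultra d -> ~ d (initial_meet t n) ->
  finite_set [set b | d (guess t j b)].
Proof.
move=> fd dn; apply: sub_finite_set (A_linked j n fd) => b /= db.
apply: filterS (filterI db (ultra_not dn)) => x [xb xn].
have [m mn [xm xm1]] : exists2 m, m <= n & initial_meet t m x /\ ~ initial_meet t m.+1 x.
  elim: n xn {dn} => [|n ih] xn; first by case: xn.
  have [xn'|xn'] := EM (initial_meet t n x); first by exists n.
  by have [m mn ?] := ih xn'; exists m => //; exact: leqW.
by apply: (A_mono mn); exact: xb.
Qed.

(** On [initial_meet t n] only levels from [n] on occur, and these contain the
sets of level [size Q]. *)
Lemma guess_condition t j (Q : seq bits) n : size Q <= n ->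
  initial_meet t n `&` condition A [:: (j, Q)] `<=`
  [set x | forall b, b \in Q -> guess t j b x].
Proof.
move=> Qn x [xn xQ] b bQ m xm xm1; apply: (A_mono (m := size Q)).
  rewrite leqNgt; apply/negP => mQ; apply: xm1; apply: initial_meetS xn.
  exact: leq_trans Qn.
by apply: (xQ (j, Q)) => //; rewrite inE.
Qed.

(** If some [initial_meet t n] cannot be adjoined while keeping independence,
then some condition [c] is the obstruction; adjoining the set defined by [c], at
the cost of the finitely many rows in [c], makes the complement of
[initial_meet t n] syndetic.  Otherwise all these sets are adjoined together
with the sets [guess t j b] for an intact row [j], which is then given up. *)
Lemma handle_task F U t : invariant_filter F -> independent F U -> (exists j, ~ U j) ->
  exists Fe : set_system S * seq J,
    [/\ F `<=` Fe.1, invariant_filter Fe.1, independent Fe.1 (U `|` [set` Fe.2])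
      & handled Fe.1 t].
Proof.
move=> Finv Find [j jU]; have [FF _ _] := Finv.
have [[n [c [B [E [[uc cU] [FB fE] BE0]]]]]|nobs] := pselect (exists n c B E,
    [/\ uniq (map fst c) /\ (forall jQ, jQ \in c -> ~ U jQ.1), F B /\ finite_set E &
    B `&` hull E (initial_meet t n) `&` hull E (condition A c) = set0]).
  exists (adjoin F [set condition A c], map fst c); split => /=.
  - by apply: adjoin_sub; exists (condition A c).
  - apply: adjoin_invariant => //; first by exists (condition A c).
    by move=> _ _ -> ->; exists (condition A c) => // x; split.
  - move=> c' uc' c'U B' E' [C [D [E'' [FC -> fE'' sub]]]] fE'.
    have [| | |x [Cx xc]] := Find (c ++ c') _ _ C (E'' `|` E') FC.
    + rewrite map_cat cat_uniq uc uc' andbT /=; apply/hasPn => i /mapP[jQ jQc' ->].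
      by apply/negP => jQc; apply: (c'U jQ jQc'); right.
    + move=> jQ; rewrite mem_cat => /orP[/cU//|/c'U h] ?; apply: h; by left.
    + by rewrite finite_setU.
    rewrite condition_cat in xc; exists x; split.
      by apply: sub; split => //; apply: hullS xc; [move=> s; left|move=> y []].
    by apply: hullS xc; [move=> s; right|move=> y []].
  - left; exists n, E; split => //; exists B, (condition A c), E; split => //.
    by move=> x [Bx xc] xn; suff : set0 x by []; rewrite -BE0.
(* The finite intersections of the sets to be adjoined. *)
pose P := [set D | exists (n : nat) (Q : seq bits),
  D = initial_meet t n `&` [set x | forall b, b \in Q -> guess t j b x]].
have P0 : P !=set0 by eexists; exists 0, [::]; reflexivity.
have Pdir D D' : P D -> P D' -> exists2 D'', P D'' & D'' `<=` D `&` D'.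
  move=> [n [Q ->]] [n' [Q' ->]].
  exists (initial_meet t (maxn n n') `&` [set x | forall b, b \in Q ++ Q' -> guess t j b x]).
    by exists (maxn n n'), (Q ++ Q').
  move=> x [xn xQ]; split; split.
  - by apply: initial_meetS xn; exact: leq_maxl.
  - by move=> b bQ; apply: xQ; rewrite mem_cat bQ.
  - by apply: initial_meetS xn; exact: leq_maxr.
  - by move=> b bQ; apply: xQ; rewrite mem_cat bQ orbT.
have adjP D : adjoin F P D -> forall D', D `<=` D' -> adjoin F P D'.
  by move=> [C [D1 [E [? ? ? sub]]]] D' DD'; exists C, D1, E; split => //; exact: subset_trans DD'.
exists (adjoin F P, [:: j]); split => /=.
- exact: adjoin_sub.
- exact: adjoin_invariant.
- move=> c uc cU B E [C [_ [E' [FC [n [Q ->]] fE' sub]]]] fE.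
  apply: contrapT => BE0; apply: nobs.
  (* The row [j] is still intact in [U], so [(j, Q) :: c] is a condition there. *)
  exists (maxn n (size Q)), ((j, Q) :: c), C, (E' `|` E); split.
  + split => [|jQ].
      rewrite /= uc andbT; apply/mapP => -[jQ jQc /= ejQ].
      by apply: (cU _ jQc); right; rewrite -ejQ /= inE.
    rewrite inE => /orP[/eqP -> //|/cU h ?]; apply: h; by left.
  + by rewrite finite_setU.
  apply/seteqP; split => // x [[Cx xn] xc]; apply: BE0.
  have {xc} : hull (E' `|` E) (condition A [:: (j, Q)] `&` condition A c) x.
    by rewrite -condition_cat.
  move=> xc; exists x; split; last by apply: hullS xc; [move=> s; right|move=> y []].
  apply: sub; split => //; apply: hullS (hullI (conj xn xc)); first by move=> s; left.
  move=> y [yn [yQ _]]; split; first by apply: initial_meetS yn; exact: leq_maxl.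
  by apply: (guess_condition (leq_maxr n (size Q))); split.
- right; split => [n|].
    have : adjoin F P (initial_meet t n `&` [set x | forall b, b \in [::] -> guess t j b x]).
      by apply: adjoin_self; exists n, [::].
    by move=> /adjP; apply => x [].
  exists (guess t j); split; last by move=> d n; exact: guess_linked.
  move=> b; have : adjoin F P (initial_meet t 0 `&` [set x | forall b', b' \in [:: b] -> guess t j b' x]).
    by apply: adjoin_self; exists 0, [:: b].
  by move=> /adjP; apply => x [_]; apply; rewrite inE.
Qed.

End Stages.

(** * A well-order of the tasks with short initial segments *)

(** For a well-order of an infinite type, this says that its order type is a
cardinal. *)
Definition short_segments (T : Type) (R : T -> T -> Prop) : Prop :=
  forall (t : T) (f : T -> T), exists y, forall s, R s t -> f s <> y.

Lemma well_order_lt (T : Type) : exists R : T -> T -> Prop,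
  [/\ well_founded R, (forall x y z, R x y -> R y z -> R x z)
    & forall x y, [\/ R x y, x = y | R y x]].
Proof.
have [le le_wo] := wochoice.well_ordering_principle {classic T}.
have min2 (P : set T) : P !=set0 -> exists2 z, P z & forall y, P y -> le z y.
  move=> [x Px]; have [|z [[zP zle] _]] := le_wo [pred x : {classic T} | `[< P x >]].
    by exists x; apply/asboolP.
  exists z; first exact/asboolP.
  by move=> y Py; apply: zle; apply/asboolP.
have le_total x y : le x y || le y x.
  have [|z [->|->] zle] := min2 [set u | u = x \/ u = y]; first by exists x; left.
    by rewrite zle //; right.
  by rewrite [X in _ || X]zle ?orbT //; left.
have le_refl x : le x x by have := le_total x x; rewrite orbb.
have le_anti x y : le x y -> le y x -> x = y.
  move=> xy yx; have [|z [_ zu]] := le_wo [pred u : {classic T} | `[< u = x \/ u = y >]].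
    by exists x; apply/asboolP; left.
  suff zP u : u = x \/ u = y -> z = u by rewrite -[x]zP; [apply: zP; right|left].
  move=> ux; apply: zu; split; first exact/asboolP.
  by move=> v /asboolP; case: ux => -> [] ->.
have le_trans x y z : le x y -> le y z -> le x z.
  move=> xy yz; have [|u uP ule] := min2 [set u | [\/ u = x, u = y | u = z]].
    by exists x; constructor 1.
  case: uP => uE; subst u.
  - by apply: ule; constructor 3.
  - by rewrite (le_anti x y) //; apply: ule; constructor 1.
  - by rewrite -(le_anti y z) //; apply: ule; constructor 2.
exists (fun x y => le x y /\ x <> y); split.
- move=> x; apply: contrapT => nx.
  have [|z nz zle] := min2 [set u | ~ Acc (fun x y => le x y /\ x <> y) u]; first by exists x.
  apply: nz; constructor => y [yz yNz]; apply: contrapT => ny.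
  by apply: yNz; apply: le_anti => //; exact: zle.
- move=> x y z [xy xNy] [yz _]; split; first exact: le_trans yz.
  by move=> xz; apply: xNy; apply: le_anti => //; rewrite xz.
- move=> x y; have [->|xy] := EM (x = y); first by constructor 2.
  have /orP[lxy|lyx] := le_total x y; first by constructor 1.
  by constructor 3; split => // /esym.
Qed.

(** In a well-order of [T], take the least point whose initial segment maps onto
[T], if there is one.  A right inverse [g] of this map embeds [T] into that
segment, and the order pulled back along [g] is as required. *)
Lemma short_well_order (T : Type) : exists R : T -> T -> Prop,
  [/\ well_founded R, (forall x y z, R x y -> R y z -> R x z),
      (forall x y, [\/ R x y, x = y | R y x]) & short_segments R].
Proof.
have [R [Rwf Rtrans Rtot]] := well_order_lt T.
pose long t := exists f : T -> T, forall y, exists2 s, R s t & f s = y.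
have [[t0 lt0]|nlong] := pselect (exists t, long t); last first.
  exists R; split => // t f; apply: contrapT => nf; apply: nlong; exists t, f => y.
  by apply: contrapT => ny; apply: nf; exists y => s st fs; apply: ny; exists s.
have {t0 lt0} [t0 [f0 f0P] t0min] : exists2 t0, long t0 & forall t, R t t0 -> ~ long t.
  elim: (Rwf t0) lt0 => t _ ih lt.
  have [[s [st ls]]|ns] := pselect (exists s, R s t /\ long s); first exact: ih ls.
  by exists t => // s st ls; apply: ns; exists s.
have [g gP] : {g : T -> T & forall y, R (g y) t0 /\ f0 (g y) = y}.
  apply: (choice (P := fun y s => R s t0 /\ f0 s = y)) => y.
  by have [s ? ?] := f0P y; exists s.
exists (fun x y => R (g x) (g y)); split.
- move=> x; have [z zE] : exists z, z = g x by exists (g x).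
  elim: (Rwf z) x zE => {}z _ ih x zE; constructor => y yx.
  by apply: ih erefl; rewrite zE.
- by move=> x y z; exact: Rtrans.
- move=> x y; case: (Rtot (g x) (g y)) => h; [by constructor 1| |by constructor 3].
  by constructor 2; rewrite -(gP x).2 h (gP y).2.
move=> t f; apply: contrapT => nf; apply: (t0min _ (gP t).1); exists (f \o f0) => y.
have [s sP fs] : exists2 s, R (g s) (g t) & f s = y.
  by apply: contrapT => ny; apply: nf; exists y => s st fs; apply: ny; exists s.
by exists (g s) => //=; rewrite (gP s).2.
Qed.

(** Koenig's diagonal argument: the [n]-th value of [j] is chosen outside of the
[n]-th values of the [n]-th members of all the lists [used s]. *)
Lemma short_segments_fresh (T : Type) (R : T -> T -> Prop) : short_segments R ->
  forall (t : T) (used : T -> seq {classic nat -> T}), exists j, forall s, R s t -> j \notin used s.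
Proof.
move=> Rshort t used.
pose nth_used s n : {classic nat -> T} := nth ((fun=> t) : {classic nat -> T}) (used s) n.
have [j jP] : {j : nat -> T & forall n s, R s t -> nth_used s n n <> j n}.
  by apply: (choice (P := fun n y => forall s, R s t -> nth_used s n n <> y)) => n;
    exact: (Rshort t (fun s => nth_used s n n)).
exists (j : {classic nat -> T}) => s st; apply/negP => js.
have := jP (index (j : {classic nat -> T}) (used s)) s st.
by rewrite /nth_used nth_index //; apply.
Qed.

(** Well-founded recursion for a functional on total functions whose value at
[t] only depends on the values below [t]. *)
Lemma well_founded_fixpoint (T X : Type) (R : T -> T -> Prop) (x0 : X)
    (G : (T -> X) -> T -> X) : well_founded R ->
  (forall f g t, (forall s, R s t -> f s = g s) -> G f t = G g t) ->
  exists f, forall t, f t = G f t.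
Proof.
move=> Rwf Gext.
pose F t (rec : forall s, R s t -> X) := G (fun s =>
  if pselect (R s t) is left h then rec s h else x0) t.
exists (Fix Rwf _ F) => t; rewrite Fix_eq /F; last first.
  move=> {}t f g fg; congr (G _ t); apply: funext => s.
  by case: pselect => // h; exact: fg.
by apply: Gext => s st; case: pselect.
Qed.

(** * The recursion over all tasks *)

(** Since [S] is countable, there are no more sequences of tasks than 0-1
sequences, which index the rows of [linked_family]. *)
Lemma tasks_encode (S : Type) : countable [set: S] ->
  exists enc : (nat -> nat -> set S) -> bits, injective enc.
Proof.
move=> /countable_injP[r rinj].
exists (fun j m => if unpickle m is Some (a, b, k) then
  `[< exists2 s, r s = k & j a b s >] else false) => j j' jj'.
apply: funext => a; apply: funext => b; apply: funext => s.
have := congr1 (fun f : bits => f (pickle (a, b, r s))) jj'; rewrite /= pickleK.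
have rE i : `[< exists2 s', r s' = r s & i a b s' >] = `[< i a b s >] :> bool.
  apply/asboolP/asboolP => [[s' /(rinj _ _ (mem_setT _) (mem_setT _)) ->]//|ias].
  by exists s.
by rewrite !rE => e; apply/propext; split => /asboolP; [rewrite e|rewrite -e] => /asboolP.
Qed.

Lemma linked_family_tasks (S : semigroupType) (J : eqType) (enc : J -> bits) :
  countable [set: S] -> infinite_set [set: S] -> weakly_cancellative S ->
  injective enc -> exists A : J -> bits -> nat -> set S,
  [/\ forall j b m n, m <= n -> A j b m `<=` A j b n,
      forall j n (d : betaS S), free_ultra d -> finite_set [set b | d (A j b n)]
    & independent A [set B | finite_set (~` B)] set0].
Proof.
move=> Sc Si Sw encI; have [A [Amono Alinked Aind]] := linked_family Sc Si Sw.
exists (fun j => A (enc j)); split; [by move=> j; exact: Amono|by move=> j; exact: Alinked|].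
move=> c uc _ B E fB fE; pose c' := [seq (enc jQ.1, jQ.2) | jQ <- c].
suff -> : condition (fun j => A (enc j)) c = condition A c'.
  apply: Aind => //; rewrite -map_comp.
  by rewrite (map_comp enc fst) map_inj_uniq.
apply/seteqP; split => x xc jQ; first by move=> /mapP[iQ iQc ->]; exact: xc iQ iQc.
by move=> jQc; apply: (xc (enc jQ.1, jQ.2)); apply: map_f jQc.
Qed.

Section Recursion.
Variables (S : semigroupType) (J : eqType) (A : J -> bits -> nat -> set S).
Hypotheses (A_mono : forall j b m n, m <= n -> A j b m `<=` A j b n)
  (A_linked : forall j n (d : betaS S), free_ultra d ->
     finite_set [set b | d (A j b n)])
  (A_independent : independent A [set B | finite_set (~` B)] set0)
  (S_weakly_cancellative : weakly_cancellative S).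
Notation task := (nat -> set S).
Notation stage := (set_system S * seq J)%type.
Variable R : task -> task -> Prop.
Hypotheses (R_wf : well_founded R) (R_trans : forall x y z, R x y -> R y z -> R x z)
  (R_total : forall x y, [\/ R x y, x = y | R y x])
  (R_fresh : forall t (used : task -> seq J), exists j, forall s, R s t -> j \notin used s).

Lemma cofinite_invariant : invariant_filter [set B : set S | finite_set (~` B)].
Proof.
split => //; last first.
  move=> B s /= fB.
  have -> : ~` (mul s @^-1` B) =
      \bigcup_(z in ~` B) ((fun x => s * x) @^-1` [set z]).
    by apply/seteqP; split => [x xB|x [z zB xz] xB]; [exists (s * x)|apply: zB; rewrite -xz].
  by apply: bigcup_finite => // z _; have [] := S_weakly_cancellative s z.
split => /=; first by rewrite setCT; exact: finite_set0.
  by move=> B C fB fC; rewrite /mkset setCI finite_setU.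
by move=> B C BC; apply: sub_finite_set => x nC Bx; apply: nC; exact: BC.
Qed.

(** The cofinite sets are added so that the union over no stage is a filter. *)
Definition stages_filter (D : set task) (f : task -> stage) : set_system S :=
  [set B | finite_set (~` B) \/ exists2 s, D s & (f s).1 B].

Definition stages_used (D : set task) (f : task -> stage) : set J :=
  [set j | exists2 s, D s & j \in (f s).2].

Definition good_stage (f : task -> stage) (t : task) : Prop :=
  [/\ stages_filter (R^~ t) f `<=` (f t).1, invariant_filter (f t).1,
      independent A (f t).1 (stages_used (R^~ t) f `|` [set` (f t).2])
    & handled (f t).1 t].

Lemma good_stage_le f s t : good_stage f t -> R s t -> (f s).1 `<=` (f t).1.
Proof. by move=> [sub _ _ _] st B sB; apply: sub; right; exists s. Qed.

(** The filters of the stages form a chain, and independence is a statement on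
one set of the filter at a time, so both invariants pass to unions. *)
Lemma stages_limit (D : set task) f : (forall s t, R s t -> D t -> D s) ->
  (forall t, D t -> good_stage f t) ->
  invariant_filter (stages_filter D f) /\
  independent A (stages_filter D f) (stages_used D f).
Proof.
move=> Ddown fgood; have [cof_filter _ cof_inv] := cofinite_invariant; split; last first.
  move=> c uc cU B E [fB|[s Ds sB]] fE; first by apply: A_independent => // jQ _ [].
  have [_ _ sind _] := fgood s Ds; apply: sind => // jQ jQc [[u us ju]|js].
    by apply: cU jQc _; exists u => //; exact: Ddown us Ds.
  by apply: cU jQc _; exists s.
split.
- split.
  + by left; rewrite setCT; exact: finite_set0.
  + move=> B C; have lim1 s : D s -> (f s).1 B -> (f s).1 C -> stages_filter D f (B `&` C).
      by move=> Ds sB sC; right; exists s => //; have [_ [FF _ _] _ _] := fgood s Ds; exact: filterI.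
    move=> [fB|[s Ds sB]] [fC|[u Du uC]].
    * by left; exact: (@filterI _ _ cof_filter).
    * by apply: (lim1 u) => //; have [sub _ _ _] := fgood u Du; apply: sub; left.
    * by apply: (lim1 s) => //; have [sub _ _ _] := fgood s Ds; apply: sub; left.
    * case: (R_total s u) => [su|su|us].
      - by apply: (lim1 u) => //; exact: (good_stage_le (fgood u Du) su).
      - by apply: (lim1 u) => //; rewrite -su.
      - by apply: (lim1 s) => //; exact: (good_stage_le (fgood s Ds) us).
  + move=> B C BC [fB|[s Ds sB]]; first by left; exact: (@filterS _ _ cof_filter) fB.
    by right; exists s => //; have [_ [FF _ _] _ _] := fgood s Ds; exact: filterS sB.
- by move=> B fB; left.
- move=> B x [fB|[s Ds sB]]; first by left; exact: cof_inv.
  by right; exists s => //; have [_ [_ _ inv] _ _] := fgood s Ds; exact: inv.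
Qed.

Lemma task_filter_recursion : exists F : set_system S,
  [/\ invariant_filter F, ~ F set0 & forall t, handled F t].
Proof.
have [next nextP] : {next : set_system S * set J * task -> stage & forall FUt,
    invariant_filter FUt.1.1 -> independent A FUt.1.1 FUt.1.2 -> (exists j, ~ FUt.1.2 j) ->
    [/\ FUt.1.1 `<=` (next FUt).1, invariant_filter (next FUt).1,
      independent A (next FUt).1 (FUt.1.2 `|` [set` (next FUt).2])
      & handled (next FUt).1 FUt.2]}.
  apply: (choice (P := fun FUt Fe => invariant_filter FUt.1.1 ->
    independent A FUt.1.1 FUt.1.2 -> (exists j, ~ FUt.1.2 j) ->
    [/\ FUt.1.1 `<=` Fe.1, invariant_filter Fe.1,
      independent A Fe.1 (FUt.1.2 `|` [set` Fe.2]) & handled Fe.1 FUt.2])).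
  move=> [[F U] t] /=.
  have [[Finv Find ex]|nh] := pselect [/\ invariant_filter F, independent A F U & exists j, ~ U j].
    by have [Fe FeP] := handle_task A_mono A_linked t Finv Find ex; exists Fe.
  by exists (F, [::]) => *; case: nh.
have [f fE] : exists f, forall t, f t =
    next (stages_filter (R^~ t) f, stages_used (R^~ t) f, t).
  apply: (well_founded_fixpoint (set0, [::]) (G := fun f t =>
    next (stages_filter (R^~ t) f, stages_used (R^~ t) f, t)) R_wf) => f g t fg.
  congr (next (_, _, _)); apply/seteqP; split => B.
  - by move=> [fB|[s st sB]]; [left|right; exists s => //; rewrite -fg].
  - by move=> [fB|[s st sB]]; [left|right; exists s => //; rewrite fg].
  - by move=> [s st sB]; exists s => //; rewrite -fg.
  - by move=> [s st sB]; exists s => //; rewrite fg.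
have fgood t : good_stage f t.
  elim: (R_wf t) => {}t _ ih; rewrite /good_stage fE.
  have [linv lind] := @stages_limit (R^~ t) f (fun s u su ut => R_trans su ut) ih.
  apply: (nextP (stages_filter (R^~ t) f, stages_used (R^~ t) f, t)) => //=; have [j jP] := R_fresh t (fun s => (f s).2).
  by exists j => -[s st]; apply/negP; exact: jP.
have [linv lind] := @stages_limit setT f (fun _ _ _ _ => I) (fun t _ => fgood t).
exists (stages_filter setT f); split => //.
- move=> F0; have [] := R_fresh (fun=> set0) (fun=> [::]) => j _.
  by have [||x []] := lind [::] _ _ set0 set0 F0 (@finite_set0 _).
- move=> t; have [_ _ _ th] := fgood t; apply: handledS th => B tB.
  by right; exists t.
Qed.

End Recursion.

Lemma task_filter (S : semigroupType) :
  countable [set: S] -> infinite_set [set: S] -> weakly_cancellative S ->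
  exists F : set_system S,
  [/\ invariant_filter F, ~ F set0 & forall t, handled F t].
Proof.
move=> Sc Si Sw; have [enc encI] := tasks_encode Sc.
pose J : eqType := {classic nat -> nat -> set S}.
have [A [Amono Alinked Aind]] := linked_family_tasks (J := J) (enc := enc) Sc Si Sw encI.
have [R [Rwf Rtrans Rtot Rshort]] := short_well_order (nat -> set S).
exact: (task_filter_recursion Amono Alinked Aind Sw Rwf Rtrans Rtot (short_segments_fresh Rshort)).
Qed.

(** * Idempotents in closed subsemigroups of beta S *)

Section Idempotent.
Variable S : semigroupType.
Implicit Types (p q x y : betaS S) (G F : set_system S).

(** The closed set of ultrafilters that corresponds to the filter [G]. *)
Definition above G : set (betaS S) := [set p | G `<=` p].

Definition subsemigroup_filter G : Prop :=
  ProperFilter G /\ forall p q, above G p -> above G q -> above G (p * q).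

Lemma above_nonempty G : ProperFilter G -> above G !=set0.
Proof. by move=> /ultraFilterLemma[p [pU Gp]]; exists (BetaS pU). Qed.

(** The filter of the closed set of all [y * x] with [y] above [G]. *)
Definition translate G x : set_system S := [set A | G [set s | x (mul s @^-1` A)]].

Lemma translate_filter G x : ProperFilter G -> ProperFilter (translate G x).
Proof.
move=> GF; apply: Build_ProperFilter_ex.
  move=> A GA; have [s xs] := filter_ex (GA : G _).
  by have [t At] := filter_ex xs; exists (s * t).
split; rewrite /translate /=.
- by apply: filterS filterT => s _; exact: filterT.
- by move=> A B; apply: (@filterS2 _ G) => s sA sB; exact: filterI.
- by move=> A B AB; apply: (@filterS _ G) => s; apply: filterS => t; exact: AB.
Qed.

Lemma above_translate G x p : Filter G ->
  above (translate G x) p <-> exists2 y, above G y & p = y * x.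
Proof.
move=> GF; split => [Gp|[y Gy ->] A GA]; last exact: Gy.
have [|||y [Gy Cy]] := @ultra_extend S G [set D | exists2 A, p A &
    [set s | x (mul s @^-1` A)] `<=` D] GF.
- by exists setT; first exact: filterT.
- move=> D D' [A pA AD] [B pB BD]; exists (A `&` B); first exact: filterI.
  by move=> s xAB; split; [apply: AD|apply: BD]; apply: filterS xAB => t [].
- move=> B D GB [A pA AD]; apply: contrapT => BD0.
  apply: (ultra_notC pA); apply: Gp; apply: filterS GB => s Bs.
  apply: ultra_not => xA; apply: BD0; exists s; split => //; exact: AD.
by exists y => //; apply: betaS_le_eq => A pA; apply: Cy; exists A.
Qed.

(** The filter of the closed set of all [y] above [G] with [y * x = x]. *)
Definition fixing G x : set_system S :=
  [set D | exists B A, [/\ G B, x A & B `&` [set s | x (mul s @^-1` A)] `<=` D]].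

Lemma above_fixing G x y : Filter G ->
  above (fixing G x) y <-> above G y /\ y * x = x.
Proof.
move=> GF; split => [Gy|[Gy yx] D [B [A [GB xA sub]]]].
  split; first by move=> B GB; apply: Gy; exists B, setT; split => //; exact: filterT.
  apply/esym/betaS_le_eq => A xA; apply: Gy; exists setT, A; split => //; exact: filterT.
apply: filterS (sub) _; apply: filterI (Gy _ GB) _.
by change (ultra_sets (y * x) A); rewrite yx.
Qed.

Lemma fixing_filter G x y : ProperFilter G -> above G y -> y * x = x ->
  ProperFilter (fixing G x).
Proof.
move=> GF Gy yx; have Fy : above (fixing G x) y by apply/above_fixing.
apply: Build_ProperFilter_ex; first by move=> D /Fy/filter_ex.
split.
- by exists setT, setT; split => //; exact: filterT.
- move=> D D' [B [A [GB xA sub]]] [B' [A' [GB' xA' sub']]].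
  exists (B `&` B'), (A `&` A'); split; [exact: filterI|exact: filterI|].
  move=> s [[Bs B's] xs]; split; [apply: sub|apply: sub']; split => //;
    by apply: filterS xs => t [].
- move=> D D' DD' [B [A [GB xA sub]]]; exists B, A; split => //.
  exact: subset_trans DD'.
Qed.

(** Larger filters have smaller closed sets, so this yields a minimal closed
subsemigroup of [above F]. *)
Lemma maximal_subsemigroup_filter F : subsemigroup_filter F ->
  exists M, [/\ F `<=` M, subsemigroup_filter M &
    forall G, subsemigroup_filter G -> M `<=` G -> G `<=` M].
Proof.
move=> Fsub; have FF := Fsub.1.
have [|M [MP Mmax]] := @Zorn_bigcup (set S)
  (* The empty system is included for the sake of the empty chain. *)
  (fun G => G = set0 \/ F `<=` G /\ subsemigroup_filter G); last first.
  have [M0|{}MP] := MP; last first.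
    exists M; split; [by case: MP|by case: MP|] => G Gsub MG.
    apply: contrapT => nGM; apply: (Mmax G); first by split.
    by right; split => //; apply: subset_trans MG; case: MP.
  suff F0 : set0 `<` F.
    by have [] := Mmax F; [rewrite M0|apply: or_intror; split => //; exact: subset_refl].
  by split=> // F0; have : F setT; [exact: filterT|exact: F0].
move=> CC CP Ctot.
have [[G0 CG0 [G0F G0sub]]|nC] := pselect (exists2 G, CC G & F `<=` G /\ subsemigroup_filter G);
    last first.
  left; apply/seteqP; split => // A [G CG GA].
  by case: (CP G CG) => [G0|G0]; [rewrite G0 in GA|case: nC; exists G].
have Cgood G A : CC G -> G A -> subsemigroup_filter G.
  by move=> CG GA; case: (CP G CG) => [G0'|[]//]; rewrite G0' in GA.
right; split; first by apply: subset_trans G0F _ => A G0A; exists G0.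
split.
  apply: Build_ProperFilter_ex.
    by move=> A [G CG GA]; have [GF _] := Cgood G A CG GA; exact: filter_ex GA.
  split.
  - by exists G0 => //; have [GF _] := G0sub; exact: filterT.
  - move=> A B [G CG GA] [H CH HB].
    have [GF _] := Cgood G A CG GA; have [HF _] := Cgood H B CH HB.
    by case: (Ctot G H CG CH) => GH; [exists H|exists G] => //; apply: filterI => //; exact: GH.
  - move=> A B AB [G CG GA]; have [GF _] := Cgood G A CG GA.
    by exists G => //; exact: filterS GA.
move=> p q Cp Cq A [G CG GA]; have [_ Gsub] := Cgood G A CG GA.
by apply: (Gsub p q) GA => B GB; [apply: Cp|apply: Cq]; exists G.
Qed.

(** Ellis' argument: in a minimal closed subsemigroup [K] with an element [x],
both [K x] and the set of all [y] in [K] with [y x = x] are closed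
subsemigroups, hence equal to [K], so that [x x = x]. *)
Lemma idempotent_above F : subsemigroup_filter F -> exists2 e, above F e & e * e = e.
Proof.
move=> /maximal_subsemigroup_filter[M [FM [MF Mmul] Mmax]].
have [x Mx] := above_nonempty MF.
have sub_translate : subsemigroup_filter (translate M x).
  split; first exact: translate_filter.
  move=> _ _ /above_translate[y My ->] /above_translate[z Mz ->]; apply/above_translate.
  by exists (y * x * z); [exact: Mmul (Mmul _ _ My Mx) Mz|rewrite !mulgA].
have [y My xE] : exists2 y, above M y & x = y * x.
  apply/above_translate; apply: subset_trans (Mx); apply: Mmax => // A MA.
  by apply: (@filter_ultraP _ M) => y My; exact: (Mmul y x My Mx A MA).
have sub_fixing : subsemigroup_filter (fixing M x).
  split; first exact: fixing_filter My (esym xE).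
  move=> p q /above_fixing[Mp px] /above_fixing[Mq qx]; apply/above_fixing.
  by split; [exact: Mmul|rewrite -mulgA qx].
have /above_fixing[_ xx] : above (fixing M x) x.
  apply: subset_trans (Mx); apply: Mmax => // A MA.
  by exists A, setT; split => //; exact: filterT.
by exists x => //; exact: subset_trans Mx.
Qed.

End Idempotent.

(** * The left ideal of the ultrafilters above the filter *)

Section FreeProducts.
Variables (S : semigroupType) (S_weakly_cancellative : weakly_cancellative S).
Implicit Types (p q : betaS S).

Lemma beta_principal_mul (s : S) q (A : set S) :
  ultra_sets (beta_principal s * q) A <-> q (mul s @^-1` A).
Proof. exact: principal_filterP. Qed.

(** Weak cancellativity: [s^-1 {t}] is finite, so it is in no free ultrafilter. *)
Lemma free_ultra_mull p q : free_ultra q -> free_ultra (p * q).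
Proof.
move=> fq [t _ tE].
have pqt : ultra_sets (p * q) [set t] by rewrite -tE; apply/principal_filterP.
have [s /= qs] := filter_ex (pqt : p [set s | q (mul s @^-1` [set t])]); apply: (free_ultra_finite fq) qs.
by have [] := S_weakly_cancellative s t.
Qed.

Lemma beta_principal_mul_inj (s : S) p q : left_cancellative S ->
  beta_principal s * p = beta_principal s * q -> p = q.
Proof.
move=> Sl e; apply: betaS_le_eq => A pA.
suff : q (mul s @^-1` (mul s @` A)).
  by apply: filterS => x [y Ay /Sl <-].
apply/beta_principal_mul; rewrite -e; apply/beta_principal_mul.
by apply: filterS pA => x Ax; exists x.
Qed.

End FreeProducts.

Lemma cantor_bits : ~ countable [set: bits].
Proof.
move=> /countable_injP[h hinj]; pose b : bits := fun n => `[< exists2 x, h x = n & ~~ x n >].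
have bE : b (h b) = ~~ b (h b).
  apply/asboolP/idP => [[x hx]|nb]; last by exists b.
  by rewrite (hinj _ _ (mem_setT _) (mem_setT _) hx).
by case: (b (h b)) bE.
Qed.

Section Ideal.
Variables (S : semigroupType) (S_weakly_cancellative : weakly_cancellative S).
Variable F : set_system S.
Hypotheses (F_invariant : invariant_filter F) (F_proper : ~ F set0)
  (F_handled : forall t, handled F t).
Local Notation L := (above F).
Implicit Types (p q : betaS S).

#[local] Instance F_filter : ProperFilter F.
Proof. by have [FF _ _] := F_invariant; split. Qed.

Lemma ideal_free : L `<=` @free_ultra S.
Proof.
move=> p Fp [s _ sE]; have [_ Fcof _] := F_invariant.
have : p (~` [set s]) by apply: Fp; apply: Fcof; rewrite setCK; exact: finite_set1.
by rewrite -sE => /principal_filterP; apply.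
Qed.

Lemma ideal_mul p q : L q -> L (p * q).
Proof.
move=> Fq A FA; have [_ _ Finv] := F_invariant.
by change (p [set s | q (mul s @^-1` A)]); apply: filterS filterT => s _; apply: Fq; exact: Finv.
Qed.

(** The task that lists only the complement of [A] has been handled. *)
Lemma ideal_syndetic p A : L p -> p A ->
  exists2 E, finite_set E & F (~` hull E (~` A)).
Proof.
move=> Fp pA; have [[n [E [fE nE]]]|[Fm _]] := F_handled (fun=> ~` A); last first.
  have pm : p (initial_meet (fun=> ~` A) 1) by exact: Fp.
  by case: (ultra_notC pA); apply: filterS pm => x /(_ 0 isT).
exists E => //; apply: filterS nE => x nx xA; apply: nx.
by apply: hullS xA => // y Ay k.
Qed.

(** By compactness it is enough that a set [A] in [p] has some translate
[s^-1 A] in [q].  Otherwise the hulls of the complement of [A] would be in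
[t q], which is in [L], against the syndeticity of [A]. *)
Lemma ideal_generated p q : L p -> L q -> exists y, p = y * q.
Proof.
move=> Fp Fq; suff [y _ yE] : exists2 y, above (globally setT) y & p = y * q by exists y.
apply/above_translate => A qA; apply: contrapT => nA.
have [E fE FE] := ideal_syndetic Fp (ultra_not nA).
have [t _] : [set: S] !=set0 by have [t] := filter_ex FE; exists t.
have := ideal_mul (beta_principal t) Fq FE; apply: ultra_notC.
rewrite setCK; apply: filter_hull => // [|s _]; first exact/beta_principal_mul/qA.
apply/beta_principal_mul; apply: filterS (qA (s * t) I) => x.
by rewrite /= mulgA.
Qed.

Lemma ideal_nonempty : L !=set0. Proof. exact: above_nonempty. Qed.

(** The generator [r r] is used instead of [r]: a product [y r] is free even if
[y] is principal, so left multiplication by it stays within left ideals of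
the free ultrafilters. *)
Lemma ideal_minimal : minimal_left_ideal (@free_ultra S) L.
Proof.
split.
  by split; [exact: ideal_nonempty|exact: ideal_free|move=> p q _; exact: ideal_mul].
move=> L' [[r L'r] L'free L'mul] L'L; apply/seteqP; split => // p Lp.
have [y ->] := ideal_generated Lp (ideal_mul r (L'L r L'r)).
rewrite mulgA; apply: L'mul => //; apply: free_ultra_mull => //; exact: L'free.
Qed.

Lemma separating_task (D : set (betaS S)) : countable D -> D `<=` ~` L ->
  exists t : nat -> set S, (forall n, F (t n)) /\ forall d, D d -> exists n, ~ d (t n).
Proof.
move=> /countable_injP[g ginj] DL.
have [t tP] : {t : nat -> set S & forall n, F (t n) /\ forall d, D d -> g d = n -> ~ d (t n)}.
  apply: (choice (P := fun n A => F A /\ forall d, D d -> g d = n -> ~ d A)) => n.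
  have [[d [Dd dn]]|nd] := pselect (exists d, D d /\ g d = n); last first.
    by exists setT; split => [|d Dd dn]; [exact: filterT|case: nd; exists d].
  have [A FA ndA] : exists2 A, F A & ~ d A.
    by apply: contrapT => nA; apply: (DL d Dd) => A FA; apply: contrapT => ndA; apply: nA; exists A.
  exists A; split => // d' Dd' d'n; suff -> : d' = d by [].
  by apply: ginj; rewrite ?inE // dn.
exists t; split => [n|d Dd]; first by have [] := tP n.
by exists (g d); have [_] := tP (g d); apply.
Qed.

(** Each point of [D] contains only finitely many of the uncountably many sets
[V b] attached to a separating task, so some [V b] is in no point of [D]. *)
Lemma ideal_weak_Pset : weak_Pset (@free_ultra S) L.
Proof.
split; first exact: ideal_free.
move=> D DL Dc; have Dfree : D `<=` @free_ultra S by move=> d /DL[].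
have [t [Ft tD]] : exists t : nat -> set S, (forall n, F (t n)) /\ forall d, D d -> exists n, ~ d (t n).
  by apply: separating_task => // d /DL[].
apply/seteqP; split => // p [clp Lp].
have {}clp := (closure_subspace_betaP (ideal_free Lp) Dfree).1 clp.
have [[n [E [fE nE]]]|[_ [V [FV Vlinked]]]] := F_handled t.
  apply: F_proper; have Fm : F (initial_meet t n).
    have Fm : F [set x | forall k, k \in iota 0 n -> t k x] by apply: filter_forall_in.
    by apply: filterS Fm => x tx k kn; apply: tx; rewrite mem_iota.
  have [_ _ Finv] := F_invariant.
  have Fh : F (hull E (initial_meet t n)) by apply: filter_hull => // s _; exact: Finv.
  by apply: filterS (filterI nE Fh) => x [].
have [b bD] : exists b, forall d, D d -> ~ d (V b).
  apply: contrapT => nb; apply: cantor_bits.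
  have : countable (\bigcup_(d in D) [set b | d (V b)]).
    apply: bigcup_countable => // d Dd; apply: finite_set_countable.
    have [n dn] := tD d Dd; apply: (Vlinked d n.+1); first exact: Dfree.
    by move=> dm; apply: dn; apply: filterS dm => x; apply.
  apply: sub_countable; apply: subset_card_le => b _; apply: contrapT => nbD.
  by apply: nb; exists b => d Dd dV; apply: nbD; exists d.
by have [d Dd dV] := clp (V b) (Lp _ (FV b)); exact: (bD d Dd).
Qed.

Lemma ideal_idempotent : exists2 e, L e & e * e = e.
Proof. by apply: idempotent_above; split => [|p q _]; [exact: F_filter|exact: ideal_mul]. Qed.

Lemma ideal_mul_idempotent p e : L p -> L e -> e * e = e -> p * e = p.
Proof. by move=> Lp Le ee; have [y ->] := ideal_generated Lp Le; rewrite -mulgA ee. Qed.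

(** Since [p q] is in the closure of the countable set of all [s q], some [s q]
is in [L]; an idempotent of [L] fixes it on the right, and [s] cancels. *)
Lemma ideal_prime : countable [set: S] -> left_cancellative S -> prime_in (@free_ultra S) L.
Proof.
move=> Sc Sl p q fp fq; split; last exact: ideal_mul.
move=> Lpq; have [s Lsq] : exists s, L (beta_principal s * q).
  apply: contrapT => ns; have [_ wP] := ideal_weak_Pset.
  pose D := range (fun s : S => beta_principal s * q).
  have DL : D `<=` @free_ultra S `\` L.
    move=> _ [s _ <-]; split; first exact: free_ultra_mull.
    by move=> Ls; apply: ns; exists s.
  have Dc : countable D by apply: sub_countable Sc; exact: card_image_le.
  suff : set0 (p * q) by [].
  rewrite -(wP D DL Dc); split => //; apply/closure_subspace_betaP.
  - exact: free_ultra_mull.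
  - by move=> d /DL[].
  - move=> A pqA; have [s /= qs] := filter_ex (pqA : p [set s | q (mul s @^-1` A)]); exists (beta_principal s * q); first by exists s.
    exact/beta_principal_mul.
have [e Le ee] := ideal_idempotent.
have := ideal_mul_idempotent Lsq Le ee; rewrite -mulgA => /(beta_principal_mul_inj Sl) <-.
exact: ideal_mul.
Qed.

End Ideal.

Theorem mainTheorem1 (S : semigroupType)
    (S_countable : countable [set: S]) (S_infinite : infinite_set [set: S])
    (S_weakly_cancellative : weakly_cancellative S) :
  exists L : set (betaS S),
    minimal_left_ideal (@free_ultra S) L /\
    weak_Pset (@free_ultra S) L /\
    (left_cancellative S ->
       prime_in (@free_ultra S) L /\
       (forall p : betaS S, L p -> p * p = p ->
          left_maximal (@free_ultra S) p /\
          minimal_idempotent (@free_ultra S) p /\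
          maximal_idempotent (@free_ultra S) p)).
Proof.
have [F [Finv Fproper Fhandled]] :=
  task_filter S_countable S_infinite S_weakly_cancellative.
exists (above F); split; first exact: ideal_minimal.
split; first exact: ideal_weak_Pset.
move=> Sl; have Lprime : prime_in (@free_ultra S) (above F) by exact: ideal_prime.
split => // p Lp pp; have fp := ideal_free Finv Lp.
have above_p q : free_ultra q -> p * q = p -> above F q.
  by move=> fq pq; apply/(Lprime p q fp fq); rewrite pq.
have right_id q : above F q -> q * p = q.
  by move=> Lq; exact: (ideal_mul_idempotent Finv Fproper Fhandled Lq Lp pp).
split; [split=> //|split; split=> //] => q [fq qq].
- by move=> pq; apply: right_id; exact: above_p.
- move=> [qp pq]; have Lq : above F q by rewrite -qp; exact: ideal_mul.
  have := ideal_mul_idempotent Finv Fproper Fhandled Lp Lq qq.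
  by rewrite pq.
- move=> [pq qp]; rewrite -(right_id q) ?qp //; exact: above_p.
Qed.
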